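(* The coefficients $a_{02}$, $a_{20}$ and $a_{11}$ are intrinsic invariants of cross caps in $\mathbf{R}^3$. That is, they are determined by the induced positive semidefinite metric: if $f_i:U_i\to\mathbf{R}^3$ ($i=0,1$; $U_i$ domains in $\mathbf{R}^2$) are $C^\infty$ maps with cross cap singularities at $p_i\in U_i$, with first fundamental forms $ds_i^2$, and if there is an orientation-preserving diffeomorphism $\psi$ from a neighborhood of $p_0$ onto a neighborhood of $p_1$ with $\psi(p_0)=p_1$ and $\psi^*ds_1^2=ds_0^2$, then the values of $a_{02}$, $a_{20}$ and $a_{11}$ for $f_0$ at $p_0$ coincide with those for $f_1$ at $p_1$.
   Context: A singular point $p$ of a $C^\infty$ map $f:U\to\mathbf{R}^3$ ($U\subset\mathbf{R}^2$ a domain) is a cross cap singularity if there are a local diffeomorphism $\varphi$ of $\mathbf{R}^2$ (taking $p$ to the origin) and a local diffeomorphism $\Phi$ of $\mathbf{R}^3$ (taking $f(p)$ to the origin) such that $\Phi\circ f=f_{\mathrm{std}}\circ\varphi$ near $p$, where $f_{\mathrm{std}}(u,v)=(u,uv,v^2)$. Normal form: at a cross cap singularity, for each $n\ge 3$, after an orientation-preserving isometry of $\mathbf{R}^3$ and an orientation-preserving local coordinate change of the domain (centered at the singular point), $f$ takes the form $$f(u,v)=\left(u,\;uv+\sum_{i=3}^n\frac{b_i}{i!}v^i,\;\sum_{r=2}^n\sum_{j=0}^r\frac{a_{j\,r-j}}{j!(r-j)!}u^jv^{r-j}\right)+O(u,v)^{n+1},\qquad a_{02}>0,$$ where $O(u,v)^{n+1}$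 denotes terms of order at least $n+1$. The coefficients $a_{jk}$ and $b_i$ are then uniquely determined and are regarded as invariants of the cross cap $f$. The first fundamental form $ds^2$ of $f$ is the positive semidefinite symmetric $2$-tensor on $U$ obtained by pulling back the Euclidean metric of $\mathbf{R}^3$ by $f$. An invariant of cross caps is called intrinsic if it can be described in terms of $ds^2$. *)

(* Defs.v *)
(* Points of R^n are row vectors 'rV[R]_n over a realType R. *)
From HB Require Import structures.
From mathcomp Require Import all_boot all_order all_algebra.
From mathcomp Require Import all_classical all_reals all_analysis.

Set Implicit Arguments.
Unset Strict Implicit.
Unset Printing Implicit Defensive.

Import Order.TTheory GRing.Theory Num.Theory.
Import numFieldNormedType.Exports.

Local Open Scope classical_set_scope.
Local Open Scope ring_scope.

Section CrossCap.
Variable R : realType.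

Definition euclid_dot n (v w : 'rV[R]_n) : R := \sum_(i < n) v 0 i * w 0 i.

(* The library norm `|x| on 'rV[R]_n is the sup norm, hence a separate
   Euclidean distance. *)
Definition euclid_dist n (x y : 'rV[R]_n) : R :=
  Num.sqrt (euclid_dot (x - y) (x - y)).

Definition iter_derive m n (vs : seq 'rV[R]_m) (f : 'rV[R]_m -> 'rV[R]_n) :
    'rV[R]_m -> 'rV[R]_n :=
  foldr (fun v g => fun x => 'D_v g x) f vs.

(* Meant for open A: differentiability of every iterated directional derivative
   gives existence and continuity of the partial derivatives of all orders. *)
Definition smooth_on m n (A : set 'rV[R]_m) (f : 'rV[R]_m -> 'rV[R]_n) : Prop :=
  forall (vs : seq 'rV[R]_m) (x : 'rV[R]_m),
    A x -> differentiable (iter_derive vs f) x.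

(* Maps are total functions; only their restrictions to A and B matter. *)
Definition diffeomorphism n (A B : set 'rV[R]_n) (phi : 'rV[R]_n -> 'rV[R]_n) :
    Prop :=
  [/\ open A, open B, smooth_on A phi, (forall x, A x -> B (phi x)) &
      exists psi : 'rV[R]_n -> 'rV[R]_n,
        [/\ smooth_on B psi, (forall y, B y -> A (psi y)),
            (forall x, A x -> psi (phi x) = x) &
            (forall y, B y -> phi (psi y) = y)]].

Definition orientation_preserving_on n (A : set 'rV[R]_n)
    (phi : 'rV[R]_n -> 'rV[R]_n) : Prop :=
  forall x, A x -> 0 < \det (jacobian phi x).

Definition local_diffeomorphism n (p : 'rV[R]_n) (phi : 'rV[R]_n -> 'rV[R]_n) :
    Prop :=
  exists A B : set 'rV[R]_n, A p /\ diffeomorphism A B phi.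

Definition orientation_preserving_local_diffeomorphism n (p : 'rV[R]_n)
    (phi : 'rV[R]_n -> 'rV[R]_n) : Prop :=
  exists A B : set 'rV[R]_n,
    [/\ A p, diffeomorphism A B phi & orientation_preserving_on A phi].

Definition orientation_preserving_isometry n (T : 'rV[R]_n -> 'rV[R]_n) : Prop :=
  (forall x y, euclid_dist (T x) (T y) = euclid_dist x y) /\
  orientation_preserving_on setT T.

Definition plane_domain (U : set 'rV[R]_2) : Prop :=
  [/\ U !=set0, open U & connected U].

Definition vec3 (x y z : R) : 'rV[R]_3 := \row_(i < 3) nth 0 [:: x; y; z] i.

Definition singular_point (f : 'rV[R]_2 -> 'rV[R]_3) (p : 'rV[R]_2) : Prop :=
  (\rank (jacobian f p) < 2)%N.

Definition f_std (w : 'rV[R]_2) : 'rV[R]_3 :=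
  let u := w 0 0 in let v := w 0 1 in vec3 u (u * v) (v ^+ 2).

Definition cross_cap (f : 'rV[R]_2 -> 'rV[R]_3) (p : 'rV[R]_2) : Prop :=
  singular_point f p /\
  exists (phi : 'rV[R]_2 -> 'rV[R]_2) (Phi : 'rV[R]_3 -> 'rV[R]_3),
    [/\ local_diffeomorphism p phi /\ phi p = 0,
        local_diffeomorphism (f p) Phi /\ Phi (f p) = 0 &
        \forall x \near p, Phi (f x) = f_std (phi x)].

Definition cross_cap_normal_form (n : nat) (a : nat -> nat -> R) (b : nat -> R)
    (w : 'rV[R]_2) : 'rV[R]_3 :=
  let u := w 0 0 in let v := w 0 1 in
  vec3 u
    (u * v + \sum_(3 <= i < n.+1) b i / i`!%:R * v ^+ i)
    (\sum_(2 <= r < n.+1) \sum_(0 <= j < r.+1)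
       a j (r - j)%N / (j`! * (r - j)`!)%:R * (u ^+ j * v ^+ (r - j))).

(* phi goes from the normal coordinates (u, v) near 0 to the domain of f
   near p.  Only b i for 3 <= i <= n and a j k for 2 <= j + k <= n matter. *)
Definition cross_cap_coefficients (n : nat) (f : 'rV[R]_2 -> 'rV[R]_3)
    (p : 'rV[R]_2) (a : nat -> nat -> R) (b : nat -> R) : Prop :=
  0 < a 0%N 2%N /\
  exists (T : 'rV[R]_3 -> 'rV[R]_3) (phi : 'rV[R]_2 -> 'rV[R]_2),
    [/\ orientation_preserving_isometry T,
        orientation_preserving_local_diffeomorphism 0 phi,
        phi 0 = p &
        (fun w : 'rV[R]_2 => T (f (phi w)) - cross_cap_normal_form n a b w)
          =O_ (nbhs (0 : 'rV[R]_2)) (fun w => `|w| ^+ n.+1)].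

Definition first_fundamental_form (f : 'rV[R]_2 -> 'rV[R]_3) (x v w : 'rV[R]_2) :
    R :=
  euclid_dot ('d f x v) ('d f x w).

Definition tensor_pullback (psi : 'rV[R]_2 -> 'rV[R]_2)
    (g : 'rV[R]_2 -> 'rV[R]_2 -> 'rV[R]_2 -> R) (x v w : 'rV[R]_2) : R :=
  g (psi x) ('d psi x v) ('d psi x w).

End CrossCap.

(* Main.v *)
Require Import Defs.
From mathcomp Require Import all_boot all_order all_algebra.
From mathcomp Require Import all_classical all_reals all_analysis.
From mathcomp Require Import ring lra.
Import Order.TTheory GRing.Theory Num.Theory.
Import numFieldNormedType.Exports.
Local Open Scope classical_set_scope.
Local Open Scope ring_scope.

(** At a cross cap the derivative of [f] kills a direction [v]. By the Koszul
    formula the metric determines [<f_zw, f_v>] near the point; differentiating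
    along [y] where [f_v = 0] shows that it determines the scalar products
    [<f_zw, f_yv>] there. Pull both maps back to the normal coordinates of the
    first one. The two normal forms then differ by an isometry of space and a
    change of coordinates, which enters these scalar products only through its
    derivative at 0: the metric also fixes [<f_zw, f_u>], so the components
    along the image line cancel. Comparing the products of
    [f_uu = (0, 0, a20)], [f_uv = (0, 1, a11)] and [f_vv = (0, 0, a02)] forces
    that derivative to be the identity up to sign and the coefficients to agree.
    The second derivatives are read off the normal forms, without differentiating
    the remainder terms, as limits of second differences. *)

(** * Calculus of functions differentiable to a finite order *)

Section FiniteDifferentiability.
Context {R : realType}.

Lemma near_eq_differentiable {V W : normedModType R} (f g : V -> W) (x : V) :
  (\near x, f x = g x) -> differentiable f x -> differentiable g x.
Proof.
move=> fg df.
have Eg : g \o shift x = cst (g x) + 'd f x +o_ 0 id.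
  apply/eqaddoP => e e0.
  have /eqaddoP/(_ e e0) := diff_locally df.
  have : \forall h \near 0, f (h + x) = g (h + x).
    by move: fg; rewrite (near_shift 0 x)/= ; apply: filterS => h; rewrite /= subr0.
  apply: filterS2 => h /= fgh; rewrite !fctE /= -fgh.
  by rewrite (nbhs_singleton fg).
have dg : 'd g x = 'd f x :> (V -> W) by apply: diff_unique => //; exact: diff_continuous.
apply/diff_locallyP; rewrite dg; split => //; exact: diff_continuous.
Qed.

(* Iterated directional derivatives of orders 0 to [k] are differentiable, so
   this is differentiability of order [k + 1]. *)
Fixpoint ndiff {m} (k : nat) (A : set 'rV[R]_m) (f : 'rV[R]_m -> R) : Prop :=
  (forall x, A x -> differentiable f x) /\
  (if k is k'.+1 then forall v, ndiff k' A ('D_v f) else True).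

Lemma ndiffS {m} {k} {A : set 'rV[R]_m} {f : 'rV[R]_m -> R} :
  ndiff k.+1 A f -> ndiff k A f.
Proof.
elim: k f => [|k IH] f [df Df]; split=> // v.
exact/IH/Df.
Qed.

Lemma ndiff_ext {m} k (A : set 'rV[R]_m) (f g : 'rV[R]_m -> R) :
  open A -> (forall x, A x -> f x = g x) -> ndiff k A f -> ndiff k A g.
Proof.
move=> Ao; elim: k f g => [|k IH] f g fg.
  case=> df _; split=> // x Ax; apply: (near_eq_differentiable f); last exact: df.
  by have := open_nbhs_nbhs (conj Ao Ax); apply: filterS.
move=> [df Df].
have nfg x : A x -> \near x, f x = g x.
  by move=> Ax; have := open_nbhs_nbhs (conj Ao Ax); apply: filterS.
split=> [x Ax|v]; first by apply: (near_eq_differentiable f); [exact: nfg|exact: df].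
apply: IH (Df v) => x Ax; apply: near_eq_derive; exact: nfg.
Qed.

Lemma ndiff_subset {m} k (A B : set 'rV[R]_m) (f : 'rV[R]_m -> R) :
  A `<=` B -> ndiff k B f -> ndiff k A f.
Proof.
move=> AB; elim: k f => [|k IH] f [df Df]; split=> //.
- by move=> x /AB; exact: df.
- by move=> x /AB; exact: df.
- by move=> v; exact/IH/Df.
Qed.

Lemma ndiff_cst {m} k (A : set 'rV[R]_m) (c : R) : ndiff k A (fun=> c).
Proof.
elim: k c => [|k IH] c; split=> //; try by move=> x _; exact: differentiable_cst.
move=> v.
have -> : 'D_v (fun=> c) = (fun=> 0) :> ('rV[R]_m -> R).
  by apply/funext => x; exact: derive_cst.
exact: IH.
Qed.

Lemma ndiffD {m} k (A : set 'rV[R]_m) (f g : 'rV[R]_m -> R) :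
  open A -> ndiff k A f -> ndiff k A g -> ndiff k A (fun x => f x + g x).
Proof.
move=> Ao; elim: k f g => [|k IH] f g [df Df] [dg Dg]; split=> //.
- by move=> x Ax; apply: differentiableD; [exact: df|exact: dg].
- by move=> x Ax; apply: differentiableD; [exact: df|exact: dg].
move=> v; apply: (ndiff_ext _ _ (fun x => 'D_v f x + 'D_v g x)) => //.
  by move=> x Ax; rewrite -deriveD //; apply: diff_derivable; [exact: df|exact: dg].
by apply: IH; [exact: Df|exact: Dg].
Qed.

Lemma ndiffM {m} k (A : set 'rV[R]_m) (f g : 'rV[R]_m -> R) :
  open A -> ndiff k A f -> ndiff k A g -> ndiff k A (fun x => f x * g x).
Proof.
move=> Ao; elim: k f g => [|k IH] f g.
  by move=> [df _] [dg _]; split=> // x Ax; apply: differentiableM; [exact: df|exact: dg].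
move=> nf ng; have [df Df] := nf; have [dg Dg] := ng; split.
  by move=> x Ax; apply: differentiableM; [exact: df|exact: dg].
move=> v; apply: (ndiff_ext _ _ (fun x => f x * 'D_v g x + g x * 'D_v f x)) => //.
  by move=> x Ax; rewrite -deriveM //; apply: diff_derivable; [exact: df|exact: dg].
by apply: ndiffD => //; apply: IH => //; [exact: ndiffS|exact: Dg|exact: ndiffS|exact: Df].
Qed.

Lemma ndiff_sum {m} k (A : set 'rV[R]_m) n (f : 'I_n -> 'rV[R]_m -> R) :
  open A -> (forall i, ndiff k A (f i)) -> ndiff k A (fun x => \sum_i f i x).
Proof.
move=> Ao; elim: n f => [|n IH] f nf.
  apply: (ndiff_ext _ _ (fun=> 0)) => //; first by move=> x _; rewrite big_ord0.
  exact: ndiff_cst.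
apply: (ndiff_ext _ _ (fun x => f ord0 x + \sum_i f (lift ord0 i) x)) => //.
  by move=> x _; rewrite big_ord_recl.
by apply: ndiffD => //; exact: IH.
Qed.

Lemma row_differentiable {V : normedModType R} {n} (g : V -> 'rV[R]_n) (x : V) :
  (forall i, differentiable (fun y => g y 0 i) x) -> differentiable g x.
Proof.
move=> dg.
have -> : g = \sum_i (fun y => g y 0 i *: delta_mx 0 i).
  by apply/funext => y; rewrite fct_sumE -row_sum_delta.
apply: differentiable_sum => i.
exact: (differentiableZl (delta_mx 0 i : 'rV[R]_n) (dg i)).
Qed.

Lemma coord_differentiable {V : normedModType R} {n} (g : V -> 'rV[R]_n) (x : V) i :
  differentiable g x -> differentiable (fun y => g y 0 i) x.
Proof.
move=> dg; apply: (differentiable_comp (g := fun M : 'rV[R]_n => M 0 i)) => //.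
exact: differentiable_coord.
Qed.

Lemma derive_coord {V : normedModType R} {n} (g : V -> 'rV[R]_n) (x v : V) i :
  differentiable g x -> 'D_v (fun y => g y 0 i) x = ('D_v g x) 0 i.
Proof. by move=> dg; rewrite derive_mx ?mxE//; exact: diff_derivable. Qed.

Lemma derive_comp_coord {m n} (f : 'rV[R]_n -> R) (g : 'rV[R]_m -> 'rV[R]_n) x v :
  differentiable f (g x) -> differentiable g x ->
  'D_v (f \o g) x = \sum_i 'D_v (fun y => g y 0 i) x * 'D_(delta_mx 0 i) f (g x).
Proof.
move=> df dg; rewrite deriveE; last exact: differentiable_comp.
rewrite diff_comp//= [X in 'd f _ X]row_sum_delta linear_sum.
apply: eq_bigr => i _.
by rewrite linearZ /= derive_coord// deriveE// deriveE.
Qed.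

(** The chain rule writes a directional derivative of [f \o g] as a sum of products of derivatives
    of the coordinates of [g] with composites ['D_(delta_mx 0 i) f \o g]. These factors have one
    order less, so induction on [k] closes. *)
Lemma ndiff_comp {m n} k (A : set 'rV[R]_m) (B : set 'rV[R]_n)
    (f : 'rV[R]_n -> R) (g : 'rV[R]_m -> 'rV[R]_n) :
  open A -> (forall x, A x -> B (g x)) ->
  ndiff k B f -> (forall i, ndiff k A (fun x => g x 0 i)) -> ndiff k A (f \o g).
Proof.
move=> Ao AB; elim: k f => [|k IH] f.
  move=> [df _] ng; split=> // x Ax; apply: differentiable_comp; last exact/df/AB.
  by apply: row_differentiable => i; have [dg _] := ng i; exact: dg.
move=> [df Df] ng.
have dg x : A x -> differentiable g x.
  by move=> Ax; apply: row_differentiable => i; have [dg _] := ng i; exact: dg.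
split=> [x Ax|v]; first by apply: differentiable_comp; [exact: dg|exact/df/AB].
apply: (ndiff_ext _ _ (fun x => \sum_i 'D_v (fun y => g y 0 i) x *
    ('D_(delta_mx 0 i) f \o g) x)) => //.
  by move=> x Ax; rewrite derive_comp_coord//; [exact/df/AB|exact: dg].
apply: ndiff_sum => // i; apply: ndiffM => //.
  by have [_] := ng i; exact.
by apply: IH; [exact: Df|move=> j; exact: ndiffS].
Qed.

Lemma smooth_on_ndiff {m n} k (A : set 'rV[R]_m) (f : 'rV[R]_m -> 'rV[R]_n) i :
  open A -> smooth_on A f -> ndiff k A (fun x => f x 0 i).
Proof.
move=> Ao; elim: k f => [|k IH] f sf.
  by split=> // x Ax; apply: coord_differentiable; exact: (sf [::]).
split=> [x Ax|v]; first by apply: coord_differentiable; exact: (sf [::]).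
apply: (ndiff_ext _ _ (fun x => ('D_v f x) 0 i)) => //.
  by move=> x Ax; rewrite derive_coord//; exact: (sf [::]).
apply: IH => vs x Ax.
(* [foldr] applies the last vector of the list first, so a derivative taken beforehand is appended
   at the end. *)
have -> : iter_derive vs ('D_v f) = iter_derive (rcons vs v) f.
  by rewrite /iter_derive foldr_rcons.
exact: sf.
Qed.

End FiniteDifferentiability.

(** * Second differences and the symmetry of second derivatives *)

Section SecondDifference.
Context {R : realType}.

Lemma is_derive_line {m} (g : 'rV[R]_m -> R) (y v : 'rV[R]_m) (s : R) :
  differentiable g (s *: v + y) ->
  is_derive s (1 : R) (fun r : R => g (r *: v + y)) ('D_v g (s *: v + y)).
Proof.
move=> dg.
have E : (fun h : R => h^-1 *: (((fun r : R => g (r *: v + y)) \o shift s) (h *: (1 : R))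
     - g (s *: v + y))) = (fun h : R => h^-1 *: ((g \o shift (s *: v + y)) (h *: v) - g (s *: v + y))).
  apply/funext => h /=; congr (_ *: (g _ - _)).
  by rewrite [h *: 1]mulr1 scalerDl addrA.
split; last by rewrite /derive E.
by rewrite /derivable E; exact: diff_derivable.
Qed.

(** The mean value theorem in the direction [v] turns the second difference into [t] times a
    difference of two values of ['D_v g], which the first-order expansion of ['D_v g] at [x]
    evaluates up to o(t). *)
Lemma cvg_second_difference {m} (g : 'rV[R]_m -> R) (x v w : 'rV[R]_m) :
  (\forall y \near x, differentiable g y) -> differentiable ('D_v g) x ->
  (g (t *: v + (t *: w + x)) - g (t *: v + x) - g (t *: w + x) + g x) / t ^+ 2
    @[t --> 0^'+] --> 'D_w ('D_v g) x.
Proof.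
move=> dg dh; set h := 'D_v g in dh *.
rewrite deriveE//.
(* The two errors of the expansion add up to at most (e / C) t (2|v| + |w|), hence to at most e t;
   the summand 1 keeps [C] positive. *)
apply/cvgrPdist_le => e e0.
pose C := 2 * `|v| + `|w| + 1.
have C0 : 0 < C by rewrite /C ltr_wpDl// addr_ge0// mulr_ge0.
have eC : 0 < e / C by rewrite divr_gt0.
have hE : \forall k \near (0 : 'rV[R]_m), `|h (k + x) - h x - 'd h x k| <= e / C * `|k|.
  have /eqaddoP/(_ _ eC) := diff_locally dh.
  by apply: filterS => k; rewrite !fctE/= opprD addrA.
have dg0 : \forall k \near (0 : 'rV[R]_m), differentiable g (k + x).
  by move: dg; rewrite (near_shift 0 x)/=; apply: filterS => k; rewrite /= subr0.
have /nbhs_normP[d/= d0 hd] : \forall k \near (0 : 'rV[R]_m),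
    `|h (k + x) - h x - 'd h x k| <= e / C * `|k| /\ differentiable g (k + x).
  by near=> k; split; near: k.
near=> t.
have t0 : 0 < t by near: t; exact: nbhs_right_gt.
have tC : t * C < d.
  rewrite -ltr_pdivlMr//; near: t; apply: nbhs_right_lt; exact: divr_gt0.
have nk s r : 0 <= s -> s <= t -> 0 <= r -> r <= t -> `|s *: v + r *: w| <= t * (`|v| + `|w|).
  move=> s0 st r0 rt; apply: le_trans (ler_normD _ _) _.
  by rewrite !normrZ !ger0_norm// mulrDr lerD// ler_wpM2r.
have bk s r : 0 <= s -> s <= t -> 0 <= r -> r <= t ->
    `|h (s *: v + r *: w + x) - h x - 'd h x (s *: v + r *: w)| <= e / C * `|s *: v + r *: w|
     /\ differentiable g (s *: v + r *: w + x).
  move=> s0 st r0 rt; apply: hd; rewrite /ball_/= sub0r normrN.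
  apply: le_lt_trans (nk _ _ s0 st r0 rt) _; apply: le_lt_trans tC.
  rewrite ler_pM2l// /C; have := normr_ge0 v; lra.
pose phi (s : R) := g (s *: v + (t *: w + x)) - g (s *: v + x).
pose dphi (s : R) := h (s *: v + (t *: w + x)) - h (s *: v + x).
have dphiE (s : R) : 0 <= s -> s <= t -> is_derive s (1 : R) phi (dphi s).
  move=> s0 st; apply: is_deriveB; apply: is_derive_line.
    by rewrite addrA; have [] := bk s t s0 st (ltW t0) (lexx t).
  by have [] := bk s 0 s0 st (lexx 0) (ltW t0); rewrite scale0r addr0.
have [c /[!in_itv]/andP[c0 ct] phiE] :
    exists2 c, c \in `]0, t[%R & phi t - phi 0 = dphi c * (t - 0).
  apply: MVT => // [s /[!in_itv]/andP[s0 st]|].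
    by apply: dphiE; exact: ltW.
  apply: derivable_within_continuous => s /[!in_itv]/andP[s0 st].
  by have [] := dphiE s s0 st.
have -> : g (t *: v + (t *: w + x)) - g (t *: v + x) - g (t *: w + x) + g x = t * dphi c.
  rewrite mulrC -[t in _ * t]subr0 -phiE /phi !scale0r !add0r; ring.
have [b1 _] := bk c t (ltW c0) (ltW ct) (ltW t0) (lexx t).
have [b2 _] := bk c 0 (ltW c0) (ltW ct) (lexx 0) (ltW t0).
have n1 := nk c t (ltW c0) (ltW ct) (ltW t0) (lexx t).
have n2 : `|c *: v| <= t * `|v| by rewrite normrZ gtr0_norm// ler_wpM2r// ltW.
rewrite scale0r addr0 in b2.
have Lt : 'd h x (c *: v + t *: w) - 'd h x (c *: v) = t * 'd h x w.
  by rewrite linearD/= addrAC subrr add0r linearZ.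
have -> : t * dphi c / t ^+ 2 = dphi c / t by field; rewrite gt_eqF.
have -> : 'd h x w - dphi c / t = (t * 'd h x w - dphi c) / t by field; rewrite gt_eqF.
rewrite normrM normfV (gtr0_norm t0) ler_pdivrMr// -Lt.
have -> : 'd h x (c *: v + t *: w) - 'd h x (c *: v) - dphi c =
   (h (c *: v + x) - h x - 'd h x (c *: v)) -
   (h (c *: v + t *: w + x) - h x - 'd h x (c *: v + t *: w)).
  rewrite /dphi -(addrA (c *: v)); ring.
apply: le_trans (ler_normB _ _) _; apply: le_trans (lerD b2 b1) _.
rewrite -mulrDr -mulrA ler_pM2l// ler_pdivrMl//.
have := lerD n2 n1; rewrite /C; nra.
Unshelve. all: by end_near. Qed.

(** The second difference is symmetric in [v] and [w], so both iterated derivatives are limits of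
    the same function. *)
Lemma derive_Schwarz {m} (A : set 'rV[R]_m) (g : 'rV[R]_m -> R) (x v w : 'rV[R]_m) :
  open A -> ndiff 1 A g -> A x -> 'D_w ('D_v g) x = 'D_v ('D_w g) x.
Proof.
move=> Ao [dg Dg] Ax.
have ndg : \forall y \near x, differentiable g y.
  by have := open_nbhs_nbhs (conj Ao Ax); apply: filterS.
have D1 u : differentiable ('D_u g) x by have [/(_ _ Ax)] := Dg u.
have := cvg_second_difference g x v w ndg (D1 v).
have := cvg_second_difference g x w v ndg (D1 w).
have -> : (fun t : R =>
     (g (t *: w + (t *: v + x)) - g (t *: w + x) - g (t *: v + x) + g x) / t ^+ 2) = (fun t => (g (t *: v + (t *: w + x)) - g (t *: v + x) - g (t *: w + x) + g x) / t ^+ 2).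
  by apply/funext => t; rewrite addrCA; congr ((_ + _) / _); exact: addrAC.
by move=> c1 c2; rewrite -(cvg_lim _ c1)// -(cvg_lim _ c2).
Qed.

End SecondDifference.

(** * The Koszul formula and what the metric determines *)

Section Koszul.
Context {R : realType} {m n : nat} {O : set 'rV[R]_m}.
Hypothesis Oo : open O.

Let nearO {x} {P : 'rV[R]_m -> Prop} : O x -> (forall y, O y -> P y) -> \near x, P x.
Proof. by move=> Ox OP; have := open_nbhs_nbhs (conj Oo Ox); apply: filterS. Qed.

Lemma derive_sumM (f g : 'I_n -> 'rV[R]_m -> R) (x z : 'rV[R]_m) :
  (forall i, differentiable (f i) x) -> (forall i, differentiable (g i) x) ->
  'D_z (fun y => \sum_i f i y * g i y) x =
  \sum_i 'D_z (f i) x * g i x + \sum_i f i x * 'D_z (g i) x.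
Proof.
move=> df dg.
have -> : (fun y => \sum_i f i y * g i y) = \sum_i (f i * g i).
  by apply/funext => y; rewrite fct_sumE.
rewrite derive_sum; last by move=> i; apply/diff_derivable/differentiableM.
rewrite -big_split; apply: eq_bigr => i _.
rewrite deriveM; [|exact: diff_derivable|exact: diff_derivable].
by rewrite addrC; congr (_ + _); exact: mulrC.
Qed.

(** Leibniz splits each derivative of the metric [g] into two terms; by the symmetry of second
    derivatives four of the six cancel and the other two are equal. *)
Lemma Koszul_formula (F : 'I_n -> 'rV[R]_m -> R) (x z v w : 'rV[R]_m) :
  let g u u' y := \sum_i 'D_u (F i) y * 'D_u' (F i) y in
  (forall i, ndiff 1 O (F i)) -> O x ->
  2 * (\sum_i 'D_z ('D_v (F i)) x * 'D_w (F i) x) =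
  'D_z (g v w) x + 'D_v (g z w) x - 'D_w (g z v) x.
Proof.
move=> g nF Ox.
have DF u i : differentiable ('D_u (F i)) x by have [_ /(_ u)[/(_ _ Ox)]] := nF i.
(* The existential hides the sums behind an opaque [K], symmetric in its first two arguments, which
   leaves an identity for [ring]. *)
have [K KE] : exists K, forall a b c,
    \sum_i 'D_a ('D_b (F i)) x * 'D_c (F i) x = K a b c :> R by eexists.
have Kc a b c : \sum_i 'D_c (F i) x * 'D_a ('D_b (F i)) x = K a b c.
  by rewrite -KE; apply: eq_bigr => i _; rewrite mulrC.
have Ks a b c : K a b c = K b a c.
  by rewrite -!KE; apply: eq_bigr => i _; rewrite (derive_Schwarz O).
have Dg a b c : 'D_a (g b c) x = K a b c + K a c b.
  by rewrite /g derive_sumM//; congr (_ + _); [exact: KE|exact: Kc].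
by rewrite !Dg KE (Ks v z w) (Ks w z v) (Ks w v z); ring.
Qed.

(* Differentiating the first identity along [y] at a point where the derivative
   along [w] vanishes leaves no third-order term, whence the second identity. *)
Lemma isometric_second_derive_dot (F G : 'I_n -> 'rV[R]_m -> R) (x z v y w : 'rV[R]_m) :
  (forall i, ndiff 2 O (F i)) -> (forall i, ndiff 2 O (G i)) -> O x ->
  (forall u u' p, O p -> \sum_i 'D_u (F i) p * 'D_u' (F i) p =
                      \sum_i 'D_u (G i) p * 'D_u' (G i) p) ->
  \sum_i 'D_z ('D_v (F i)) x * 'D_w (F i) x = \sum_i 'D_z ('D_v (G i)) x * 'D_w (G i) x
  /\ ((forall i, 'D_w (F i) x = 0) -> (forall i, 'D_w (G i) x = 0) ->
  \sum_i 'D_z ('D_v (F i)) x * 'D_y ('D_w (F i)) x =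
  \sum_i 'D_z ('D_v (G i)) x * 'D_y ('D_w (G i)) x).
Proof.
move=> nF nG Ox FG.
have K p : O p -> \sum_i 'D_z ('D_v (F i)) p * 'D_w (F i) p =
                  \sum_i 'D_z ('D_v (G i)) p * 'D_w (G i) p.
  move=> Op; apply: (mulfI (_ : 2 != 0 :> R)); first by rewrite pnatr_eq0.
  apply: eq_trans (Koszul_formula F p z v w (fun i => ndiffS (nF i)) Op) _.
  apply/esym/(eq_trans (Koszul_formula G p z v w (fun i => ndiffS (nG i)) Op))/esym.
  have DE a b c : 'D_a (fun q => \sum_i 'D_b (F i) q * 'D_c (F i) q) p =
                  'D_a (fun q => \sum_i 'D_b (G i) q * 'D_c (G i) q) p.
    by apply: near_eq_derive; apply: (nearO Op) => q Oq; exact: FG.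
  exact: (congr2 (fun s t : R => s - t) (congr2 +%R (DE z v w) (DE v z w)) (DE w z v)).
split; first exact: K.
move=> F0 G0.
have DH (H : 'I_n -> 'rV[R]_m -> R) : (forall i, ndiff 2 O (H i)) ->
    (forall i, 'D_w (H i) x = 0) ->
    'D_y (fun q => \sum_i 'D_z ('D_v (H i)) q * 'D_w (H i) q) x =
    \sum_i 'D_z ('D_v (H i)) x * 'D_y ('D_w (H i)) x.
  move=> nH H0; rewrite derive_sumM.
  - by rewrite big1 ?add0r// => i _; rewrite H0 mulr0.
  - by move=> i; have [_ /(_ v)[_ /(_ z)[/(_ _ Ox)]]] := nH i.
  - by move=> i; have [_ /(_ w)[/(_ _ Ox)]] := nH i.
apply: eq_trans (esym (DH F nF F0)) _.
apply: eq_trans _ (DH G nG G0); apply: near_eq_derive; exact: (nearO Ox).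
Qed.

End Koszul.

(** * One-sided limits at 0 and normal forms along curves *)

Section NormalFormLimits.
Context {R : realType}.

Lemma cvg_exprn {T : Type} {F : set_system T} {FF : Filter F} (f : T -> R) (l : R) k :
  f @ F --> l -> f x ^+ k @[x --> F] --> l ^+ k.
Proof. by move=> fl; exact: (cvg_comp _ (fun x : R => x ^+ k) fl (@exprn_continuous R k l)). Qed.

Lemma cvg_sum_nat {T : Type} {F : set_system T} {FF : Filter F} (p q : nat)
    (f : nat -> T -> R) (l : nat -> R) :
  (forall i, (p <= i < q)%N -> f i @ F --> l i) ->
  \sum_(p <= i < q) f i x @[x --> F] --> \sum_(p <= i < q) l i.
Proof.
move=> fl; rewrite big_nat; under eq_cvg do rewrite big_nat.
by apply: cvg_big => //; exact: add_continuous.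
Qed.

Lemma at_right0_id : t @[t --> (0 : R)^'+] --> (0 : R).
Proof. by apply: cvg_at_right_filter; exact: cvg_id. Qed.

Lemma cvg_at_right_eq (f g : R -> R) (l : R) :
  (forall t, 0 < t -> f t = g t) -> f @ 0^'+ --> l -> g @ 0^'+ --> l.
Proof.
move=> fg; apply: cvg_trans; apply: near_eq_cvg; near=> t.
by apply/fg; near: t; exact: nbhs_right_gt.
Unshelve. all: by end_near. Qed.

Lemma cvg0_norm_le {V : normedModType R} (f : R -> V) (s : R -> R) :
  (\forall t \near 0^'+, `|f t| <= s t) -> s @ 0^'+ --> (0 : R) -> f @ 0^'+ --> (0 : V).
Proof.
move=> fs /cvgr0Pnorm_le s0; apply/cvgr0Pnorm_le => e e0.
have := s0 _ e0; apply: filterS2 fs => t fs /(le_trans (ler_norm _)); exact: le_trans.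
Qed.

Context {c : R -> 'rV[R]_2} {z : 'rV[R]_2}.
Hypothesis cz : forall i, c t 0 i / t @[t --> 0^'+] --> z 0 i.

(** The curve [c] leaves 0 with velocity [z]. The factor [0 ^+ (j + k - 2)] is 1 for [j + k = 2] and
    0 beyond: exactly the quadratic monomials survive the division by [t ^+ 2]. *)
Lemma cvg_monomial (j k : nat) : (2 <= j + k)%N ->
  c t 0 0 ^+ j * c t 0 1 ^+ k / t ^+ 2 @[t --> 0^'+] -->
  z 0 0 ^+ j * z 0 1 ^+ k * 0 ^+ (j + k - 2).
Proof.
move=> jk.
apply: (cvg_at_right_eq (fun t => (c t 0 0 / t) ^+ j * (c t 0 1 / t) ^+ k * t ^+ (j + k - 2))).
  move=> t t0.
  have E : t ^+ j * t ^+ k = t ^+ 2 * t ^+ (j + k - 2) by rewrite -!exprD subnKC.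
  rewrite !expr_div_n mulf_div E.
  by rewrite invfM mulrA mulfVK// expf_neq0// gt_eqF.
apply: cvgM; last exact/cvg_exprn/at_right0_id.
by apply: cvgM; exact: cvg_exprn.
Qed.

(** The summand [r = 2] of the third component of the normal form. *)
Definition quadratic_jet (a : nat -> nat -> R) (w : 'rV[R]_2) : R :=
  a 2 0 / 2 * w 0 0 ^+ 2 + a 1 1 * (w 0 0 * w 0 1) + a 0 2 / 2 * w 0 1 ^+ 2.

(** Column 1 is the second component, counted from 0: its quadratic part is [u * v], and the terms
    in [b] start in degree 3. *)
Lemma cvg_normal_form1 n a b :
  cross_cap_normal_form n a b (c t) 0 1 / t ^+ 2 @[t --> 0^'+] --> z 0 0 * z 0 1.
Proof.
rewrite /cross_cap_normal_form /vec3.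
under eq_cvg do rewrite mxE/= mulrDl mulr_suml.
rewrite -[z 0 0 * z 0 1]addr0; apply: cvgD.
  have := cvg_monomial 1 1 isT; rewrite !expr1 mulr1; exact.
suff : \sum_(3 <= i < n.+1) b i / i`!%:R * c t 0 1 ^+ i / t ^+ 2 @[t --> 0^'+] -->
    \sum_(3 <= i < n.+1) b i / i`!%:R * 0.
  by rewrite [X in _ --> X -> _]big1// => i _; rewrite mulr0.
apply: cvg_sum_nat => i /andP[i3 _].
under eq_cvg do rewrite -mulrA.
apply: cvgMl_tmp.
have := cvg_monomial 0 i (ltnW i3); rewrite add0n !expr0 mul1r.
under eq_cvg do rewrite expr0 mul1r.
by rewrite (_ : 0 ^+ (i - 2) = 0) ?mulr0// expr0n; case: i i3 => [|[|[|]]].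
Qed.

Lemma cvg_normal_form2 n a b : (2 <= n)%N ->
  cross_cap_normal_form n a b (c t) 0 2 / t ^+ 2 @[t --> 0^'+] --> quadratic_jet a z.
Proof.
move=> n2; rewrite /cross_cap_normal_form /vec3.
under eq_cvg do rewrite mxE/= mulr_suml.
(* In this form the limit can be taken term by term; the factor [0 ^+ (r - 2)] kills every [r] above
   2. *)
have -> : quadratic_jet a z = \sum_(2 <= r < n.+1) \sum_(0 <= j < r.+1)
    a j (r - j)%N / (j`! * (r - j)`!)%:R * (z 0 0 ^+ j * z 0 1 ^+ (r - j) * 0 ^+ (r - 2)).
  rewrite big_ltn ?ltnS// [X in _ + X]big_nat_cond [X in _ + X]big1; last first.
    move=> r /andP[/andP[r2 _] _]; apply: big1 => j _.
    rewrite (_ : 0 ^+ (r - 2) = 0) ?mulr0// expr0n.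
    by case: r r2 => [|[|[|]]].
  rewrite addr0 unlock /= /quadratic_jet !subn0 !expr0 !expr1 !factS !fact0 !muln1 !mul1n.
  by rewrite /reducebig/=; field.
apply: (cvg_sum_nat _ _ (fun r t => (\sum_(0 <= j < r.+1)
    a j (r - j)%N / (j`! * (r - j)`!)%:R * (c t 0 0 ^+ j * c t 0 1 ^+ (r - j))) / t ^+ 2)).
move=> r /andP[r2 _]; under eq_cvg do rewrite mulr_suml.
apply: (cvg_sum_nat _ _ (fun j t => a j (r - j)%N / (j`! * (r - j)`!)%:R *
    (c t 0 0 ^+ j * c t 0 1 ^+ (r - j)) / t ^+ 2)) => j /andP[_ jr]; under eq_cvg do rewrite -mulrA.
apply: cvgMl_tmp.
by have := cvg_monomial j (r - j); rewrite subnKC//; exact.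
Qed.

(** Since [c t] is of order [t], a remainder of order [k.+1] is of order [t ^+ k.+1] along the
    curve, and one factor [t] is left after the division. *)
Lemma cvg_curve_norm k (h : 'rV[R]_2 -> 'rV[R]_3) i : (1 <= k)%N ->
  h =O_ (nbhs (0 : 'rV[R]_2)) (fun w => `|w| ^+ k.+1) ->
  h (c t) 0 i / t ^+ k @[t --> 0^'+] --> (0 : R).
Proof.
move=> k1 /eqO_exP[C C0 hC].
(* [t * s t] bounds the sup norm of [c t], and [s] has a finite limit. *)
pose s (t : R) := `|c t 0 0 / t| + `|c t 0 1 / t|.
have sl : s t @[t --> 0^'+] --> `|z 0 0| + `|z 0 1| by apply: cvgD; exact: cvg_norm.
have cs t : 0 < t -> `|c t| <= t * s t.
  move=> t0; rewrite /s !normrM !normfV !(gtr0_norm t0) -mulrDl mulrC divfK ?gt_eqF//.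
  rewrite [leLHS]/Num.Def.normr/= mx_normrE; apply: bigmax_le => [|[i' j] _ /=].
    by rewrite addr_ge0.
  rewrite (ord1 i') ; case: j => [[|[|//]] jlt].
    by rewrite (_ : Ordinal jlt = 0) ?lerDl//; exact: val_inj.
  by rewrite (_ : Ordinal jlt = 1) ?lerDr//; exact: val_inj.
have c0 : c t @[t --> 0^'+] --> (0 : 'rV[R]_2).
  apply: (cvg0_norm_le _ (fun t => t * s t)).
  - near=> t; apply: cs; near: t; exact: nbhs_right_gt.
  - have : t * s t @[t --> 0^'+] --> 0 * (`|z 0 0| + `|z 0 1|).
      exact: cvgM at_right0_id sl.
    by rewrite mul0r.
have {}hC : \forall t \near 0^'+, `|h (c t)| <= C * `| `|c t| ^+ k.+1 |.
  exact: (c0 _ hC).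
apply: (cvg0_norm_le _ (fun t => C * (s t ^+ k.+1 * t))).
- near=> t.
  have t0 : 0 < t by near: t; exact: nbhs_right_gt.
  rewrite normrM normfV [`|t ^+ k|]gtr0_norm ?exprn_gt0// ler_pdivrMr ?exprn_gt0//.
  apply: (@le_trans _ _ `|h (c t)|).
    rewrite [leRHS]/Num.Def.normr/= mx_normrE.
    by apply: (le_trans _ (le_bigmax _ _ (0, i))).
  apply: (@le_trans _ _ (C * `| `|c t| ^+ k.+1 |)); first by near: t.
  rewrite -!mulrA ler_pM2l// -exprS mulrC -exprMn ger0_norm ?exprn_ge0//.
  by apply: lerXn2r; rewrite ?nnegrE// ?(le_trans _ (cs t t0))//; exact: cs.
- have : C * (s t ^+ k.+1 * t) @[t --> 0^'+] --> C * ((`|z 0 0| + `|z 0 1|) ^+ k.+1 * 0).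
    by apply: cvgMl_tmp; apply: cvgM; [exact: cvg_exprn|exact: at_right0_id].
  by rewrite !mulr0.
Unshelve. all: by end_near. Qed.

End NormalFormLimits.

(** * Isometries of Euclidean space are affine *)

Section EuclideanIsometry.
Context {R : realType} {n : nat}.
Implicit Types v w : 'rV[R]_n.

Lemma euclid_dotE v w : euclid_dot v w = (v *m w^T) 0 0.
Proof. by rewrite mxE; apply: eq_bigr => i _; rewrite mxE. Qed.

Lemma euclid_dot_mulmx (M : 'M[R]_n) v w : M *m M^T = 1%:M ->
  euclid_dot (v *m M) (w *m M) = euclid_dot v w.
Proof. by move=> MM; rewrite !euclid_dotE trmx_mul mulmxA -[_ *m M *m _]mulmxA MM mulmx1. Qed.

Lemma euclid_dot_ge0 v : 0 <= euclid_dot v v.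
Proof. by apply: sumr_ge0 => i _; exact: sqr_ge0. Qed.

Lemma euclid_dotBB v w : euclid_dot (v - w) (v - w) =
  euclid_dot v v - 2 * euclid_dot v w + euclid_dot w w.
Proof.
rewrite /euclid_dot mulr_sumr -sumrB -big_split/=; apply: eq_bigr => i _.
rewrite !mxE; ring.
Qed.

(** The map [S], which is [T] minus [T 0], preserves squared norms, hence scalar products by
    polarization. So the scalar products of [S x] with the images of the basis vectors are the
    coordinates of [x]: multiplication by [M^T] undoes [S]. *)
Lemma isometry_affine (T : 'rV[R]_n -> 'rV[R]_n) :
  (forall x y, euclid_dist (T x) (T y) = euclid_dist x y) ->
  exists2 M : 'M[R]_n, M *m M^T = 1%:M & forall x, T x = T 0 + x *m M.
Proof.
move=> isoT.
have dT x y : euclid_dot (T x - T y) (T x - T y) = euclid_dot (x - y) (x - y).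
  have /eqP := isoT x y.
  rewrite /euclid_dist eqr_sqrt ?euclid_dot_ge0//; exact/eqP.
pose S x := T x - T 0.
have S2 x : euclid_dot (S x) (S x) = euclid_dot x x by rewrite dT subr0.
have SS x y : euclid_dot (S x) (S y) = euclid_dot x y.
  have : euclid_dot (S x - S y) (S x - S y) = euclid_dot (x - y) (x - y).
    by rewrite (_ : S x - S y = T x - T y) ?dT// /S opprB addrA subrK.
  rewrite (euclid_dotBB (S x)) (euclid_dotBB x) !S2; lra.
pose M : 'M[R]_n := \matrix_i S (delta_mx 0 i).
have SM x : S x *m M^T = x.
  apply/rowP => i; rewrite mxE.
  transitivity (euclid_dot (S x) (S (delta_mx 0 i))).
    by apply: eq_bigr => j _; rewrite !mxE.
  by rewrite SS /euclid_dot (bigD1 i)//= mxE !eqxx mulr1 big1 ?addr0// => j ji;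
    rewrite mxE eqxx (negPf ji) mulr0.
have MM : M *m M^T = 1%:M.
  apply/row_matrixP => i; rewrite row_mul rowK SM rowE mulmx1//.
exists M => // x.
by rewrite -[x in RHS]SM -mulmxA (mulmx1C MM) mulmx1 /S addrC subrK.
Qed.

End EuclideanIsometry.

(** * Derivatives at 0 read off from limits along rays *)

Section JetsFromLimits.
Context {R : realType} {m : nat} {O : set 'rV[R]_m} {P : 'rV[R]_m -> R}.
Hypotheses (Oo : open O) (O0 : O 0) (nP : ndiff 1 O P) (P0 : P 0 = 0).

Lemma derive_eq_limit (z : 'rV[R]_m) (l : R) :
  P (t *: z) / t @[t --> 0^'+] --> l -> 'D_z P 0 = l.
Proof.
move=> cl; have [dP _] := nP.
have /cvg_ex[l' cl'] : derivable P 0 z by exact/diff_derivable/dP.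
rewrite /derive (cvg_lim _ cl')//.
have E : (fun h : R => h^-1 *: ((P \o shift 0) (h *: z) - P 0)) = (fun h => P (h *: z) / h).
  by apply/funext => h /=; rewrite P0 subr0 addr0 [_ *: _]mulrC.
rewrite E in cl'.
have cr := cvg_dnbhs_at_right cl'.
exact: (cvg_unique _ cr cl).
Qed.

(** Because [P 0 = 0], the second difference at 0 is [P (t *: (v + w)) - P (t *: v) - P (t *: w)],
    so the iterated derivative is the polarization of [q]. *)
Lemma derive2_eq_limit (q : 'rV[R]_m -> R) :
  (forall z, P (t *: z) / t ^+ 2 @[t --> 0^'+] --> q z) ->
  (forall z, 'D_z P 0 = 0) /\
  (forall v w, 'D_w ('D_v P) 0 = q (v + w) - q v - q w).
Proof.
move=> cq; split=> [z|v w].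
  apply: derive_eq_limit.
  apply: (cvg_at_right_eq (fun t => P (t *: z) / t ^+ 2 * t)).
    by move=> t t0; field; rewrite gt_eqF.
  have : P (t *: z) / t ^+ 2 * t @[t --> 0^'+] --> q z * 0.
    by apply: cvgM => //; exact: at_right0_id.
  by rewrite mulr0.
have [dP DP] := nP.
have ndP : \forall y \near 0, differentiable P y.
  by have := open_nbhs_nbhs (conj Oo O0); apply: filterS.
have Dv : differentiable ('D_v P) 0 by have [/(_ _ O0)] := DP v.
have c1 := cvg_second_difference P 0 v w ndP Dv.
have c2 : P (t *: (v + w)) / t ^+ 2 - P (t *: v) / t ^+ 2 - P (t *: w) / t ^+ 2
   @[t --> 0^'+] --> q (v + w) - q v - q w.
  by apply: cvgB => //; exact: cvgB.
apply: (cvg_unique _ _ c2) => //.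
apply: cvg_at_right_eq c1 => t t0.
by rewrite !addr0 P0 scalerDr addr0 !mulrBl.
Qed.

End JetsFromLimits.

(* [(al, p)] and [(0, q)] are the rows of the Jacobian matrix of the change of
   normal coordinates; the five equations compare the scalar products of the
   second derivatives. *)
Lemma cross_cap_second_order_uniqueness {R : realType}
    (a20 a11 a02 a20' a11' a02' al p q : R) :
  0 < a02 -> 0 < a02' -> al ^+ 2 = 1 -> 0 < al * q ->
  a02 * a02 = (a02' * q ^+ 2) * (a02' * q ^+ 2) ->
  a11 * a02 = (a11' * (al * q) + a02' * (p * q)) * (a02' * q ^+ 2) ->
  1 + a11 * a11 = (al * q) ^+ 2 + (a11' * (al * q) + a02' * (p * q)) ^+ 2 ->
  a20 * a02 = (a20' * al ^+ 2 + 2 * a11' * (al * p) + a02' * p ^+ 2) * (a02' * q ^+ 2) ->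
  a20 * a11 = 2 * (al * p) * (al * q) +
    (a20' * al ^+ 2 + 2 * a11' * (al * p) + a02' * p ^+ 2) *
    (a11' * (al * q) + a02' * (p * q)) ->
  [/\ a02 = a02', a20 = a20' & a11 = a11'].
Proof.
move=> h02 h02' al2 alq E1 E2 E3 E4 E5.
have q0 : q != 0 by apply: contraTneq alq => ->; rewrite mulr0 ltxx.
(* [E1] equates the squares of two nonnegative numbers. *)
have e02 : a02' * q ^+ 2 = a02.
  apply/eqP; rewrite -(@eqrXn2 _ 2)//; last exact: ltW.
    by rewrite !expr2 -E1.
  by rewrite mulr_ge0 ?sqr_ge0// ltW.
have n02 : a02 != 0 by rewrite gt_eqF.
rewrite e02 in E2 E4.
move/(mulIf n02) in E2; move/(mulIf n02) in E4.
rewrite -E2 in E3 E5; rewrite -E4 in E5.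
(* [E3] now says that [al * q] has square 1, and its sign selects the root 1. *)
have alq1 : al * q = 1.
  apply/eqP; rewrite -(@eqrXn2 _ 2)// ?ltW//; apply/eqP; rewrite expr1n.
  by move: E3; rewrite expr2 -!expr2 => /addIr.
have q1 : q = al by rewrite -[q]mul1r -al2 expr2 -mulrA alq1 mulr1.
(* [E5] is reduced to 2 (al p) (al q) = 0, and [al = q] does not vanish. *)
have p0 : p = 0.
  move: E5; rewrite alq1 mulr1 -{1}[a20 * a11]add0r => /addIr/esym/eqP.
  rewrite !mulf_eq0 pnatr_eq0/= -q1 (negPf q0)/=; exact/eqP.
rewrite p0 alq1 in E2; rewrite p0 al2 in E4; rewrite q1 al2 mulr1 in e02.
split; [by []|rewrite E4; ring|rewrite E2; ring].
Qed.

(** * Second-order comparison of two normal forms with the same metric *)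

Section SecondOrderNormalForm.
Context {R : realType}.

(* What remains, to second order, of the normal form with coefficients [a]
   precomposed with a local chart fixing 0 whose Jacobian matrix there is [L]. *)
Definition second_order_normal (a : nat -> nat -> R) (L : 'M[R]_2) 
    (F : 'rV[R]_2 -> 'rV[R]_3) :=
  [/\ F 0 = 0,
      forall z, F (t *: z) 0 0 / t @[t --> 0^'+] --> (z *m L) 0 0,
      forall z, F (t *: z) 0 1 / t ^+ 2 @[t --> 0^'+] --> (z *m L) 0 0 * (z *m L) 0 1 &
      forall z, F (t *: z) 0 2 / t ^+ 2 @[t --> 0^'+] --> quadratic_jet a (z *m L)].

Lemma sum_ord3 (V : zmodType) (u : 'I_3 -> V) : \sum_i u i = u 0 + u 1 + u 2.
Proof. by rewrite !big_ord_recl big_ord0 addr0 addrA; congr (u _ + u _ + u _); exact: val_inj. Qed.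

(* [d z] and [h w v] are the first and iterated second derivatives at 0 of a
   map as in [second_order_normal]; the first component of [h] is left free
   because it involves the second derivative of the chart. *)
Definition jets_of_normal_form (a : nat -> nat -> R) (L : 'M[R]_2)
    (d : 'rV[R]_2 -> 'I_3 -> R) (h : 'rV[R]_2 -> 'rV[R]_2 -> 'I_3 -> R) :=
  [/\ forall z, [/\ d z 0 = (z *m L) 0 0, d z 1 = 0 & d z 2 = 0],
      forall v w, h w v 1 = (v *m L) 0 0 * (w *m L) 0 1 + (v *m L) 0 1 * (w *m L) 0 0 &
      forall v w, h w v 2 = a 2 0 * ((v *m L) 0 0 * (w *m L) 0 0) +
        a 1 1 * ((v *m L) 0 0 * (w *m L) 0 1 + (v *m L) 0 1 * (w *m L) 0 0) +
        a 0 2 * ((v *m L) 0 1 * (w *m L) 0 1)].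

(** The last two components have finite limits after division by [t ^+ 2], so their first
    derivatives vanish at 0; polarizing the limits gives their second derivatives. *)
Lemma second_order_normal_derive (O : set 'rV[R]_2) a L (F : 'rV[R]_2 -> 'rV[R]_3) :
  open O -> O 0 -> (forall i, ndiff 1 O (fun y => F y 0 i)) -> second_order_normal a L F ->
  jets_of_normal_form a L (fun z i => 'D_z (fun y => F y 0 i) 0)
    (fun z v i => 'D_z ('D_v (fun y => F y 0 i)) 0).
Proof.
move=> Oo O0 nF [F0 c0 c1 c2].
have Fi0 i : F 0 0 i = 0 by rewrite F0 mxE.
have [D1 DD1] := derive2_eq_limit Oo O0 (nF 1) (Fi0 1) _ c1.
have [D2 DD2] := derive2_eq_limit Oo O0 (nF 2) (Fi0 2) _ c2.
split.
- by move=> z; split => //; exact: (derive_eq_limit O0 (nF 0) (Fi0 0) _ _ (c0 z)).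
- by move=> v w; rewrite DD1 mulmxDl !mxE; ring.
- by move=> v w; rewrite DD2 mulmxDl /quadratic_jet !mxE; field.
Qed.

Lemma det_mx2 (L : 'M[R]_2) : \det L = L 0 0 * L 1 1 - L 0 1 * L 1 0.
Proof.
rewrite (expand_det_row _ 0) !big_ord_recl big_ord0 addr0 /cofactor !det_mx11 !mxE/=.
rewrite !expr0 !expr1 mul1r mulN1r mulrN.
by congr (L _ _ * L _ _ - L _ _ * L _ _); exact: val_inj.
Qed.

Lemma ord3_ind (P : 'I_3 -> Prop) : P 0 -> P 1 -> P 2 -> forall i, P i.
Proof.
move=> P0 P1 P2 [[|[|[|//]]] ilt].
- by rewrite (_ : Ordinal ilt = 0)//; exact: val_inj.
- by rewrite (_ : Ordinal ilt = 1)//; exact: val_inj.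
- by rewrite (_ : Ordinal ilt = 2)//; exact: val_inj.
Qed.

(** [e1] spans the kernel of the differential [dF]. Equality of the metrics makes it a kernel vector
    of [dG] as well, so [L] is triangular, with [L 0 0] equal to 1 or -1. *)
Lemma isometric_jets (a a' : nat -> nat -> R) L dF dG hF hG :
  jets_of_normal_form a 1%:M dF hF -> jets_of_normal_form a' L dG hG ->
  (forall u u', \sum_i dF u i * dF u' i = \sum_i dG u i * dG u' i) ->
  (forall z v y w, \sum_i hF z v i * dF w i = \sum_i hG z v i * dG w i /\
    ((forall i, dF w i = 0) -> (forall i, dG w i = 0) ->
      \sum_i hF z v i * hF y w i = \sum_i hG z v i * hG y w i)) ->
  0 < a 0 2 -> 0 < a' 0 2 -> 0 < \det L ->
  [/\ a 0 2 = a' 0 2, a 2 0 = a' 2 0 & a 1 1 = a' 1 1].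
Proof.
move=> [F1 F2 F3] [G1 G2 G3] FG K a0 a'0 detL.
pose e0 : 'rV[R]_2 := delta_mx 0 0; pose e1 : 'rV[R]_2 := delta_mx 0 1.
have eL0 i : (e0 *m L) 0 i = L 0 i by rewrite -rowE mxE.
have eL1 i : (e1 *m L) 0 i = L 1 i by rewrite -rowE mxE.
have [e00 e01] : (e0 *m 1%:M) 0 0 = 1 /\ (e0 *m 1%:M) 0 1 = 0 by rewrite mulmx1 !mxE.
have [e10 e11] : (e1 *m 1%:M) 0 0 = 0 /\ (e1 *m 1%:M) 0 1 = 1 by rewrite mulmx1 !mxE.
have m11 := FG e1 e1; have m00 := FG e0 e0.
rewrite !sum_ord3 in m11 m00.
have [Fx0 Fy0 Fz0] := F1 e0; have [Fx1 Fy1 Fz1] := F1 e1.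
have [Gx0 Gy0 Gz0] := G1 e0; have [Gx1 Gy1 Gz1] := G1 e1.
rewrite Fx1 Fy1 Fz1 Gx1 Gy1 Gz1 e10 eL1 !mulr0 !addr0 in m11.
rewrite Fx0 Fy0 Fz0 Gx0 Gy0 Gz0 e00 eL0 !mulr0 !addr0 mulr1 in m00.
have be0 : L 1 0 = 0 by apply/eqP; rewrite -sqrf_eq0 expr2 -m11.
have al2 : L 0 0 ^+ 2 = 1 by rewrite expr2 -m00.
rewrite det_mx2 be0 mulr0 subr0 in detL.
(* Testing against [e0] relates the first components by the sign [L 0 0], so the second derivative
   of the chart need not be known. *)
have X z v : hF z v 0 = hG z v 0 * L 0 0.
  have [+ _] := K z v e0 e0; rewrite !sum_ord3.
  by rewrite Fx0 Fy0 Fz0 Gx0 Gy0 Gz0 e00 eL0 !mulr0 !addr0 mulr1.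
(* Since [L 0 0 ^+ 2 = 1], the products of first components agree and cancel. *)
have KK z v y : hF z v 1 * hF y e1 1 + hF z v 2 * hF y e1 2 =
                hG z v 1 * hG y e1 1 + hG z v 2 * hG y e1 2.
  have [_] := K z v y e1; rewrite !sum_ord3 !X.
  have F0 : forall i, dF e1 i = 0 by apply: ord3_ind; rewrite ?Fx1 ?Fy1 ?Fz1.
  have G0 : forall i, dG e1 i = 0 by apply: ord3_ind; rewrite ?Gx1 ?Gy1 ?Gz1 ?eL1.
  move=> /(_ F0 G0); rewrite mulrACA -expr2 al2 mulr1 -!addrA; exact: addrI.
(* Without first components, these compare the products f_vv.f_vv, f_uv.f_vv, f_uv.f_uv, f_uu.f_vv
   and f_uu.f_uv, in this order. *)
have k1 := KK e1 e1 e1; have k2 := KK e0 e1 e1; have k3 := KK e0 e1 e0.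
have k4 := KK e0 e0 e1; have k5 := KK e0 e0 e0.
rewrite !F2 !F3 !G2 !G3 !eL0 !eL1 e00 e01 e10 e11 be0 in k1 k2 k3 k4 k5.
move: k1 k2 k3 k4 k5.
set al := L 0 0 in al2 detL *; set p := L 0 1; set q := L 1 1 in detL *.
move: (a 0 2) (a 2 0) (a 1 1) (a' 0 2) (a' 2 0) (a' 1 1) a0 a'0 =>
  a02 a20 a11 a02' a20' a11' a0 a0' k1 k2 k3 k4 k5.
apply: (@cross_cap_second_order_uniqueness _ _ _ _ _ _ _ al p q) => //.
- by clear -k1; lra.
- by clear -k2; lra.
- by clear -k3; lra.
- by clear -k4; lra.
- by clear -k5; lra.
Qed.

Lemma isometric_second_order_normal (O : set 'rV[R]_2) (a a' : nat -> nat -> R) L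
    (F G : 'rV[R]_2 -> 'rV[R]_3) :
  open O -> O 0 ->
  (forall i, ndiff 2 O (fun y => F y 0 i)) -> (forall i, ndiff 2 O (fun y => G y 0 i)) ->
  (forall u u' p, O p ->
    \sum_i 'D_u (fun y => F y 0 i) p * 'D_u' (fun y => F y 0 i) p =
    \sum_i 'D_u (fun y => G y 0 i) p * 'D_u' (fun y => G y 0 i) p) ->
  second_order_normal a 1%:M F -> second_order_normal a' L G ->
  0 < a 0 2 -> 0 < a' 0 2 -> 0 < \det L ->
  [/\ a 0 2 = a' 0 2, a 2 0 = a' 2 0 & a 1 1 = a' 1 1].
Proof.
move=> Oo O0 nF nG FG jF jG.
have JF := second_order_normal_derive _ _ _ _ Oo O0 (fun i => ndiffS (nF i)) jF.
have JG := second_order_normal_derive _ _ _ _ Oo O0 (fun i => ndiffS (nG i)) jG.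
apply: (isometric_jets _ _ _
  (fun z i => 'D_z (fun y => F y 0 i) 0) (fun z i => 'D_z (fun y => G y 0 i) 0)
  (fun z v i => 'D_z ('D_v (fun y => F y 0 i)) 0)
  (fun z v i => 'D_z ('D_v (fun y => G y 0 i)) 0) JF JG).
- by move=> u u'; exact: FG.
- move=> z v y w; exact: (isometric_second_derive_dot Oo
    (fun i y => F y 0 i) (fun i y => G y 0 i) 0 z v y w nF nG O0 FG).
Qed.

End SecondOrderNormalForm.

(** * Composition with charts and isometries *)

Section CompositesAndCharts.
Context {R : realType}.

Lemma jacobian_comp {m n p} (f : 'rV[R]_m -> 'rV[R]_n) (g : 'rV[R]_n -> 'rV[R]_p) x :
  differentiable f x -> differentiable g (f x) ->
  jacobian (g \o f) x = jacobian f x *m jacobian g (f x).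
Proof.
move=> df dg; apply/row_matrixP => i; rewrite row_mul !rowE.
rewrite -deriveEjacobian; last exact: differentiable_comp.
rewrite -deriveEjacobian// -deriveEjacobian// !deriveE//; last exact: differentiable_comp.
by rewrite diff_comp.
Qed.

Lemma smooth_on_differentiable {m n} {A : set 'rV[R]_m} {f : 'rV[R]_m -> 'rV[R]_n} {x} :
  smooth_on A f -> A x -> differentiable f x.
Proof. by move=> sf; exact: (sf [::]). Qed.

(** By the chain rule the two Jacobian matrices multiply to the identity, so their determinants
    multiply to 1. *)
Lemma det_jacobian_left_inverse {n} (A : set 'rV[R]_n) (f g : 'rV[R]_n -> 'rV[R]_n) x :
  open A -> A x -> differentiable f x -> differentiable g (f x) ->
  (forall y, A y -> g (f y) = y) -> 0 < \det (jacobian f x) -> 0 < \det (jacobian g (f x)).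
Proof.
move=> Ao Ax df dg gf fpos.
have J1 : jacobian f x *m jacobian g (f x) = 1%:M.
  rewrite -jacobian_comp//; apply/row_matrixP => i; rewrite !rowE mulmx1.
  rewrite -deriveEjacobian; last exact: differentiable_comp.
  rewrite -[RHS](@derive_id R _ x); apply: near_eq_derive.
  by have := open_nbhs_nbhs (conj Ao Ax); apply: filterS => y /gf.
have := congr1 determinant J1; rewrite det_mulmx det1 => d1.
by rewrite -(pmulr_rgt0 _ fpos) d1.
Qed.

Lemma open_preimage_in {m n} (A : set 'rV[R]_m) (B : set 'rV[R]_n) (f : 'rV[R]_m -> 'rV[R]_n) :
  open A -> open B -> (forall x, A x -> differentiable f x) ->
  open [set x | A x /\ B (f x)].
Proof.
move=> Ao Bo df; rewrite openE => x [Ax Bfx]; rewrite /interior/=.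
have := open_nbhs_nbhs (conj Ao Ax).
have : \forall y \near x, B (f y).
  by apply: (differentiable_continuous (df x Ax)); exact: open_nbhs_nbhs.
by apply: filterS2 => y By Ay; split.
Qed.

(** * Affine isometries of space preserve the induced metric *)

Section Affine.
Context {m : nat} {T : 'rV[R]_3 -> 'rV[R]_3} {M : 'M[R]_3}.
Hypotheses (MM : M *m M^T = 1%:M) (TE : forall x, T x = T 0 + x *m M).

Lemma affine_coord (h : 'rV[R]_m -> 'rV[R]_3) i :
  (fun y => T (h y) 0 i) = (fun y => T 0 0 i + \sum_j h y 0 j * M j i).
Proof. by apply/funext => y; rewrite TE !mxE. Qed.

Lemma ndiff_affine k A (h : 'rV[R]_m -> 'rV[R]_3) i :
  open A -> (forall j, ndiff k A (fun y => h y 0 j)) -> ndiff k A (fun y => T (h y) 0 i).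
Proof.
move=> Ao nh; rewrite affine_coord; apply: ndiffD => //; first exact: ndiff_cst.
by apply: ndiff_sum => // j; apply: ndiffM => //; exact: ndiff_cst.
Qed.

Lemma derive_affine (h : 'rV[R]_m -> 'rV[R]_3) x v i : differentiable h x ->
  'D_v (fun y => T (h y) 0 i) x = ('d h x v *m M) 0 i.
Proof.
move=> dh; rewrite affine_coord.
have dc j : differentiable (fun y => h y 0 j) x by exact: coord_differentiable.
have dM j : differentiable (fun=> M j i : R) x by exact: differentiable_cst.
have ds : differentiable (fun y => \sum_j h y 0 j * M j i) x.
  rewrite (_ : (fun y => _) = \sum_j ((fun y => h y 0 j) * (fun=> M j i))).
    by apply: differentiable_sum => j; exact: differentiableM.
  by apply/funext => y; rewrite fct_sumE.
rewrite (@deriveD _ _ _ (fun=> T 0 0 i))//; last exact: diff_derivable.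
rewrite derive_cst add0r derive_sumM// [X in _ + X]big1 ?addr0; last first.
  by move=> j _; rewrite derive_cst mulr0.
by rewrite mxE; apply: eq_bigr => j _; rewrite derive_coord// deriveE.
Qed.

Lemma metric_affine_comp (h : 'rV[R]_m -> 'rV[R]_3) x v w : differentiable h x ->
  \sum_i 'D_v (fun y => T (h y) 0 i) x * 'D_w (fun y => T (h y) 0 i) x =
  euclid_dot ('d h x v) ('d h x w).
Proof.
move=> dh; rewrite -(euclid_dot_mulmx M)//.
by apply: eq_bigr => i _; congr (_ * _); exact: derive_affine.
Qed.

End Affine.

(** The ray [t *: z] is sent by the chart to a curve with velocity [z *m jacobian c 0]. The
    remainder vanishes in the limit after division by [t] or [t ^+ 2], so the limits are those of
    the normal form along this curve. *)
Lemma second_order_normal_comp n a b (S : 'rV[R]_2 -> 'rV[R]_3)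
    (c : 'rV[R]_2 -> 'rV[R]_2) (F : 'rV[R]_2 -> 'rV[R]_3) : (3 <= n)%N ->
  (fun w : 'rV[R]_2 => S w - cross_cap_normal_form n a b w)
    =O_ (nbhs (0 : 'rV[R]_2)) (fun w => `|w| ^+ n.+1) ->
  c 0 = 0 -> differentiable c 0 -> (\forall x \near (0 : 'rV[R]_2), F x = S (c x)) ->
  second_order_normal a (jacobian c 0) F.
Proof.
move=> n3 SO c0 dc FS.
(* Where |w| <= 1, a remainder of order [n.+1] is also one of each lower order. *)
have SO' k : (k <= n)%N -> (fun w : 'rV[R]_2 => S w - cross_cap_normal_form n a b w)
    =O_ (nbhs (0 : 'rV[R]_2)) (fun w => `|w| ^+ k.+1).
  move=> kn; move/eqO_exP : SO => [C C0 hC]; apply/eqO_exP; exists C => //.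
  have n1 : \forall w \near (0 : 'rV[R]_2), `|w| <= 1.
    by apply: nbhs0_le; exact: ltr01.
  apply: filterS2 hC n1 => w hw w1; apply: (le_trans hw); rewrite ler_pM2l//.
  by rewrite !ger0_norm ?exprn_ge0//; exact: ler_wiXn2l.
have N0 : cross_cap_normal_form n a b 0 = 0.
  apply/rowP => i; rewrite mxE; case: i => [[|[|[|//]]] ilt]/=; rewrite ?mxE//.
    rewrite mul0r add0r big_nat_cond big1// => j /andP[/andP[j3 _] _].
    by rewrite expr0n; case: j j3 => [|j] _ //=; rewrite mulr0.
  rewrite big_nat_cond big1// => r /andP[/andP[r2 _] _].
  rewrite big1// => j _; rewrite !expr0n.
  case: j => [|j]/=; last by rewrite mul0r mulr0.
  by rewrite subn0; case: r r2 => [|r] _//=; rewrite mulr0 mulr0.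
(* The bound on the remainder holds at 0 itself, where it forces [S 0 = 0]. *)
have F0 : F 0 = 0.
  rewrite (nbhs_singleton FS) c0; apply/eqP.
  move/eqO_exP : SO => [C C0 /nbhs_singleton].
  by rewrite N0 subr0 normr0 expr0n/= normr0 mulr0 normr_le0.
have cz (z : 'rV[R]_2) i : c (t *: z) 0 i / t @[t --> 0^'+] --> (z *m jacobian c 0) 0 i.
  rewrite -deriveEjacobian// -derive_coord//.
  have dci := coord_differentiable _ _ i dc.
  have /cvg_ex[l cl] : derivable (fun y => c y 0 i) 0 z by exact: diff_derivable.
  rewrite /derive (cvg_lim _ cl)//; move/cvg_dnbhs_at_right : cl; apply: cvg_trans.
  apply: near_eq_cvg; near=> t => /=.
  by rewrite c0 addr0 mxE subr0 [_ *: _]mulrC.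
have nF z : \forall t \near (0:R)^'+, F (t *: z) = S (c (t *: z)).
  have : (fun t : R => t *: z) @ 0^'+ --> (0 : 'rV[R]_2).
    rewrite -[X in _ --> X](scale0r z); apply: cvgZr_tmp; exact: at_right0_id.
  by move=> /(_ _ FS).
have D k z i (l : R) : (1 <= k <= n)%N ->
    cross_cap_normal_form n a b (c (t *: z)) 0 i / t ^+ k @[t --> 0^'+] --> l ->
    F (t *: z) 0 i / t ^+ k @[t --> 0^'+] --> l.
  move=> /andP[k1 kn] cl; rewrite -[l]addr0.
  have : cross_cap_normal_form n a b (c (t *: z)) 0 i / t ^+ k +
      (S (c (t *: z)) - cross_cap_normal_form n a b (c (t *: z))) 0 i / t ^+ k
      @[t --> 0^'+] --> l + 0.
    by apply: cvgD cl _; exact: (cvg_curve_norm (cz z) k _ i k1 (SO' _ kn)).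
  apply: cvg_trans; apply: near_eq_cvg; near=> t => /=.
  have -> : F (t *: z) = S (c (t *: z)) by near: t; exact: nF.
  rewrite -mulrDl; congr (_ / _).
  by move: (cross_cap_normal_form _ _ _ _) => N; rewrite !mxE; ring.
split=> // z.
- apply: (D 1%N) => //; first by rewrite (leq_trans _ n3).
  under eq_cvg do rewrite /cross_cap_normal_form /vec3 mxE/= expr1.
  exact: cz.
- apply: (D 2%N) => //; first by rewrite (leq_trans _ n3).
  exact: (cvg_normal_form1 (cz z)).
- apply: (D 2%N) => //; first by rewrite (leq_trans _ n3).
  by apply: (cvg_normal_form2 (cz z)); rewrite (leq_trans _ n3).
Unshelve. all: by end_near. Qed.

End CompositesAndCharts.

(** * Both maps in the normal coordinates of the first one *)

Theorem theorem6 (R : realType)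
    (U0 U1 : set 'rV[R]_2) (f0 f1 : 'rV[R]_2 -> 'rV[R]_3) (p0 p1 : 'rV[R]_2)
    (V0 V1 : set 'rV[R]_2) (psi : 'rV[R]_2 -> 'rV[R]_2)
    (n0 n1 : nat) (a0 a1 : nat -> nat -> R) (b0 b1 : nat -> R) :
  plane_domain U0 -> plane_domain U1 ->
  smooth_on U0 f0 -> smooth_on U1 f1 ->
  U0 p0 -> U1 p1 ->
  cross_cap f0 p0 -> cross_cap f1 p1 ->
  (3 <= n0)%N -> (3 <= n1)%N ->
  cross_cap_coefficients n0 f0 p0 a0 b0 ->
  cross_cap_coefficients n1 f1 p1 a1 b1 ->
  V0 `<=` U0 -> V1 `<=` U1 -> V0 p0 -> V1 p1 ->
  diffeomorphism V0 V1 psi -> orientation_preserving_on V0 psi ->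
  psi p0 = p1 ->
  (forall x v w : 'rV[R]_2, V0 x ->
     tensor_pullback psi (first_fundamental_form f1) x v w =
     first_fundamental_form f0 x v w) ->
  [/\ a0 0%N 2%N = a1 0%N 2%N,
      a0 2%N 0%N = a1 2%N 0%N &
      a0 1%N 1%N = a1 1%N 1%N].
Proof.
move=> _ _ sf0 sf1 Up0 Up1 _ _ n03 n13 [a0pos cc0] [a1pos cc1] VU0 VU1 V0p V1p.
case: cc0 => T0 [phi0 [[iso0 _] [A0 [B0 [A00 df0 or0]]] phi00 SO0]].
case: cc1 => T1 [phi1 [[iso1 _] [A1 [B1 [A10 df1 or1]]] phi10 SO1]].
case: df0 => A0o B0o sphi0 AB0 _.
case: df1 => A1o B1o sphi1 AB1 [inv1 [sinv1 BA1 inv1K phi1K]].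
case=> V0o V1o spsi VV _ orpsi psip FG.
have [M0 MM0 T0E] := isometry_affine _ iso0.
have [M1 MM1 T1E] := isometry_affine _ iso1.
(* The normal coordinates of [f0] whose image under the chart lies in the domain of [psi]. *)
pose O := [set x | A0 x /\ V0 (phi0 x)].
have dphi0 x : A0 x -> differentiable phi0 x by exact: smooth_on_differentiable.
have dpsi x : V0 x -> differentiable psi x by exact: smooth_on_differentiable.
have Oo : open O by exact: open_preimage_in.
have O0 : O 0 by split=> //; rewrite phi00.
(* On [O] the maps [f0 \o phi0] and [f1 \o h] induce the same metric. *)
pose h := psi \o phi0.
have dh x : O x -> differentiable h x.
  by move=> [Ax Vx]; apply: differentiable_comp; [exact: dphi0|exact: dpsi].
have Vh x : O x -> V1 (h x) by move=> [_ /VV].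
have h0 : h 0 = p1 by rewrite /h/= phi00.
have dinv1 y : B1 y -> differentiable inv1 y by exact: smooth_on_differentiable.
have B1p : B1 p1 by rewrite -phi10; exact: AB1.
(* The change of normal coordinates: near 0, [h] is [phi1 \o c], so up to [T1] and the remainder
   [f1 \o h] is the normal form of [f1] precomposed with [c]. *)
pose c := inv1 \o h.
have c0 : c 0 = 0 by rewrite /c/= h0 -phi10 inv1K.
have dc : differentiable c 0.
  by apply: differentiable_comp; [exact: dh|rewrite h0; exact: dinv1].
have df0x x : V0 x -> differentiable f0 x.
  by move=> /VU0; exact: smooth_on_differentiable.
have df1x x : V1 x -> differentiable f1 x.
  by move=> /VU1; exact: smooth_on_differentiable.
have nphi0 k i : ndiff k O (fun x => phi0 x 0 i).
  by apply: (ndiff_subset _ _ A0) => [x []//|]; exact: smooth_on_ndiff.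
have nh k i : ndiff k O (fun x => h x 0 i).
  apply: (ndiff_comp _ O V0 (fun y => psi y 0 i)) => // [x []//|].
  exact: smooth_on_ndiff.
have nf0 k i : ndiff k O (fun x => f0 (phi0 x) 0 i).
  apply: (ndiff_comp _ O V0 (fun y => f0 y 0 i)) => // [x []//|].
  by apply: smooth_on_ndiff => // vs x /VU0; exact: sf0.
have nf1 k i : ndiff k O (fun x => f1 (h x) 0 i).
  apply: (ndiff_comp _ O V1 (fun y => f1 y 0 i)) => //.
  by apply: smooth_on_ndiff => // vs x /VU1; exact: sf1.
apply: (isometric_second_order_normal O a0 a1 (jacobian c 0)
    (fun x => T0 (f0 (phi0 x))) (fun x => T1 (f1 (h x)))) => //.
- by move=> i; apply: (ndiff_affine T0E).
- by move=> i; apply: (ndiff_affine T1E).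
(* [T0] and [T1] preserve the scalar products of differentials; what is left is the chain rule and
   the pullback hypothesis [FG]. *)
- move=> u u' x Ox; have [Ax Vx] := Ox.
  rewrite (metric_affine_comp MM0 T0E (f0 \o phi0)); last first.
    by apply: differentiable_comp; [exact: dphi0|exact: df0x].
  rewrite (metric_affine_comp MM1 T1E (f1 \o h)); last first.
    by apply: differentiable_comp; [exact: dh|exact/df1x/Vh].
  have D0 v : 'd (f0 \o phi0) x v = 'd f0 (phi0 x) ('d phi0 x v).
    exact: (congr1 (fun k => k v) (diff_comp (dphi0 _ Ax) (df0x _ Vx))).
  have D1 v : 'd (f1 \o h) x v = 'd f1 (h x) ('d h x v).
    exact: (congr1 (fun k => k v) (diff_comp (dh _ Ox) (df1x _ (Vh _ Ox)))).
  have Dh v : 'd h x v = 'd psi (phi0 x) ('d phi0 x v).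
    exact: (congr1 (fun k => k v) (diff_comp (dphi0 _ Ax) (dpsi _ Vx))).
  have D1h v := eq_trans (D1 v) (congr1 ('d f1 (h x)) (Dh v)).
  apply: eq_trans (congr2 (@euclid_dot R 3) (D0 u) (D0 u')) _.
  apply: eq_trans _ (esym (congr2 (@euclid_dot R 3) (D1h u) (D1h u'))).
  exact: (esym (FG (phi0 x) ('d phi0 x u) ('d phi0 x u') Vx)).
(* The first map is already in its own normal coordinates, so its chart is the identity. *)
- have -> : 1%:M = jacobian (@id 'rV[R]_2) 0.
    apply/row_matrixP => i; rewrite !rowE mulmx1 -deriveEjacobian ?derive_id//.
  apply: (second_order_normal_comp n0 a0 b0 (fun w => T0 (f0 (phi0 w))) id) => //.
  by near=> x.
- apply: (second_order_normal_comp n1 a1 b1 (fun w => T1 (f1 (phi1 w))) c) => //.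
  have : \forall x \near (0 : 'rV[R]_2), B1 (h x).
    by apply: (differentiable_continuous (dh 0 O0)); rewrite h0; exact: open_nbhs_nbhs.
  by apply: filterS => x Bx; rewrite /c/= phi1K.
(* The determinant is a product of three positive ones, from [phi0], [psi] and the inverse of
   [phi1]. *)
- rewrite (jacobian_comp h inv1 0 (dh 0 O0)); last by rewrite h0; exact: dinv1.
  rewrite det_mulmx (jacobian_comp phi0 psi 0); [|exact: dphi0|by rewrite phi00; exact: dpsi].
  rewrite det_mulmx; apply: mulr_gt0; first apply: mulr_gt0.
  + exact: or0.
  + by rewrite phi00; exact: orpsi.
  + rewrite h0 -phi10; apply: (det_jacobian_left_inverse A1) => //.
    * exact: (smooth_on_differentiable sphi1).
    * by rewrite phi10; exact: dinv1.
    * exact: or1.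
Unshelve. all: by end_near. Qed.
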